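(* Let $\Gamma=(V,E)$ be a genuine strongly walk-regular graph of valency $k$ with $n=|V|$ vertices and adjacency spectrum $\{[k]^1,[\frac{k}{2}]^{\alpha},[0]^{\beta},[-\frac{k}{2}]^{\gamma}\}$. Then: (i) $\alpha=\frac{2n}{k}-3$, $\beta=n+3-\frac{4n}{k}$ and $\gamma=\frac{2n}{k}-1$; in particular these are positive integers. (ii) $2k\le n\le\frac{3}{4}k^3$. (iii) For $x\in V$, let $t_x$ be the number of triangles of $\Gamma$ containing $x$. Then $t_x=\frac{3k^3}{8n}$; in particular this is an integer. (iv) Let $q$ be the number of quadrangles (cycles of length $4$) in $\Gamma$ and, for $x\in V$, let $q_x$ be the number of quadrangles containing $x$. Then $q=\frac{k}{32}\left(3k^3+nk^2-8nk+4n\right)$ and $q_x=\frac{k}{8n}\left(3k^3+nk^2-8nk+4n\right)$; in particular these are integers.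
   Context: Graphs are finite and simple. Let $A$ be the adjacency matrix and $J$ the all-ones matrix. For an integer $\ell\ge2$, a graph is strongly $\ell$-walk-regular if $A^\ell$ is a linear combination of $I$, $A$ and $J$; it is strongly walk-regular if it is strongly $\ell$-walk-regular for some $\ell\ge2$. A genuine strongly walk-regular graph is a connected regular strongly walk-regular graph whose adjacency matrix has exactly four distinct eigenvalues. The notation $\{[\lambda_1]^{m_1},\dots,[\lambda_s]^{m_s}\}$ denotes the multiset of adjacency eigenvalues, $\lambda_i$ having multiplicity $m_i$ (the $\lambda_i$ distinct). *)

(* Defs.v *)
From mathcomp Require Import all_boot all_order all_algebra.

Set Implicit Arguments.
Unset Strict Implicit.
Unset Printing Implicit Defensive.

Import Order.TTheory GRing.Theory Num.Theory.
Local Open Scope ring_scope.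

Record sgraph := SGraph {
  vertex :> finType;
  adj : rel vertex;
  adj_sym : symmetric adj;
  adj_irr : irreflexive adj
}.

Definition connected_graph (G : sgraph) : Prop :=
  forall x y : G, connect (@adj G) x y.

Definition regular_graph (G : sgraph) (k : nat) : Prop :=
  forall x : G, #|[set y | adj x y]| = k.

(* The adjacency matrix is real symmetric, so all its complex eigenvalues are
   real: nothing is lost by taking eigenvalues in a real closed field. *)
Definition adjacency (R : rcfType) (G : sgraph) : 'M[R]_#|G| :=
  \matrix_(i, j) (adj (enum_val i) (enum_val j))%:R.

Definition strongly_walk_regular_at (R : rcfType) (G : sgraph) (l : nat) : Prop :=
  exists a b c : R,
    adjacency R G ^+ l = a *: 1%:M + b *: adjacency R G + c *: const_mx 1.

Definition strongly_walk_regular (R : rcfType) (G : sgraph) : Prop :=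
  exists2 l : nat, (2 <= l)%N & strongly_walk_regular_at R G l.

Definition has_distinct_eigenvalues (R : rcfType) (n : nat) (A : 'M[R]_n)
    (d : nat) : Prop :=
  exists s : seq R, [/\ uniq s, size s = d & eigenvalue A =i s].

Definition genuine_swr (R : rcfType) (G : sgraph) : Prop :=
  [/\ connected_graph G,
      exists k : nat, regular_graph G k,
      strongly_walk_regular R G &
      has_distinct_eigenvalues (adjacency R G) 4].

(* [s] lists pairs (eigenvalue, multiplicity). *)
Definition has_spectrum (R : rcfType) (G : sgraph) (s : seq (R * nat)) : Prop :=
  uniq (unzip1 s) /\
  char_poly (adjacency R G) = \prod_(p <- s) ('X - p.1%:P) ^+ p.2.

(* For m >= 3: the cycles of length m (as subgraphs, not necessarily induced),
   each one represented by its set of edges, so that the 2m cyclic orderings of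
   its vertices are identified. *)
Definition cycles (G : sgraph) (m : nat) : {set {set {set G}}} :=
  [set [set:: [seq [set p.1; p.2] | p <- zip c (rot 1 c)]]
    | c : m.-tuple G & ucycleb (@adj G) c].

Definition cycles_at (G : sgraph) (m : nat) (x : G) : {set {set {set G}}} :=
  [set C in cycles G m | x \in cover C].

Definition triangles_at (G : sgraph) (x : G) := cycles_at 3 x.

Definition quadrangles (G : sgraph) := cycles G 4.

Definition quadrangles_at (G : sgraph) (x : G) := cycles_at 4 x.

(* Main.v *)
(** Symmetry of A gives ker B^m = ker B for B = A - a, so the characteristic
    polynomial can be replaced by the product of its distinct factors. By
    connectedness the k-eigenvectors are constant, so
    A (A - k/2) (A + k/2) is a multiple c J of the all-ones matrix, and row sums
    give c = 3k^3/(4n). Hence A^3 and A^4 have constant diagonal, which counts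
    closed 3-walks (twice the triangles) and closed 4-walks (twice the
    quadrangles, plus the degenerate ones) at each vertex. The multiplicities come
    from tr A = 0 and tr A^2 = nk. *)
Require Import Defs.
From mathcomp Require Import all_boot all_order all_algebra.
From mathcomp Require Import ring lra zify.

Set Implicit Arguments.
Unset Strict Implicit.
Unset Printing Implicit Defensive.

Import Order.TTheory GRing.Theory Num.Theory.
Local Open Scope ring_scope.

(** * Symmetric matrices, characteristic polynomials and traces *)

(** For [C = B *m M] the matrix [C^T *m C] vanishes, and its diagonal entries are sums of squares of
    entries of [C]. *)
Lemma sym_mulmx_sq_eq0 (R : realDomainType) n m (B : 'M[R]_n) (M : 'M_(n, m)) :
  B^T = B -> B *m (B *m M) = 0 -> B *m M = 0.
Proof.
move=> symB BBM0; set C := B *m M.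
have CC0 : C^T *m C = 0 by rewrite trmx_mul symB -mulmxA BBM0 mulmx0.
apply/matrixP => i j; rewrite [RHS]mxE; apply/eqP; rewrite -sqrf_eq0.
have /eqP : (C^T *m C) j j = 0 by rewrite CC0 mxE.
rewrite mxE psumr_eq0 => [/allP/(_ i)|l _]; rewrite mxE -expr2 ?sqr_ge0 //.
by rewrite mem_index_enum => /(_ isT).
Qed.

(** Factors [B] are removed one at a time. The exponent 0 is allowed because a listed multiplicity
    may a priori be zero. *)
Lemma sym_exp_mul_eq0 (R : realDomainType) n (B C : 'M[R]_n) m :
  B^T = B -> B ^+ m * C = 0 -> B * C = 0.
Proof.
move=> symB; elim: m => [|[|m] IHm]; first by rewrite mul1r => ->; rewrite mulr0.
  by rewrite expr1.
move=> BC0; apply: IHm; rewrite exprS -mulrA; apply: sym_mulmx_sq_eq0 => //.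
by move: BC0; rewrite !exprS -!mulrA.
Qed.

(** Cayley-Hamilton, after which [sym_exp_mul_eq0] brings each exponent to one. *)
Lemma sym_char_poly_annihilator (R : realDomainType) n (A : 'M[R]_n)
    (s : seq (R * nat)) :
  A^T = A -> char_poly A = \prod_(p <- s) ('X - p.1%:P) ^+ p.2 ->
  \prod_(p <- s) (A - p.1%:M) = 0.
Proof.
case: n A => [A _ _|n A symA charA]; first by rewrite [LHS]flatmx0 [RHS]flatmx0.
have hornerXsubC a : horner_mx A ('X - a%:P) = A - a%:M.
  by rewrite rmorphB /= horner_mx_X horner_mx_C.
(* The cofactor [q] collects the factors already reduced, which lets the induction on [s] go
   through. *)
suff red q : horner_mx A ((\prod_(p <- s) ('X - p.1%:P) ^+ p.2) * q) = 0 ->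
    horner_mx A ((\prod_(p <- s) ('X - p.1%:P)) * q) = 0.
  have /red : horner_mx A ((\prod_(p <- s) ('X - p.1%:P) ^+ p.2) * 1) = 0.
    by rewrite mulr1 -charA Cayley_Hamilton.
  rewrite mulr1 rmorph_prod /= => <-.
  by apply: eq_bigr => p _; rewrite -hornerXsubC.
elim: s q {charA} => [|p s IHs] q; first by rewrite !big_nil.
rewrite !big_cons -!mulrA rmorphM rmorphXn /= hornerXsubC => /sym_exp_mul_eq0.
rewrite linearB /= symA tr_scalar_mx => /(_ erefl).
rewrite -hornerXsubC -rmorphM mulrCA => /IHs.
by rewrite mulrCA.
Qed.

(** Substituting $X^2$ is injective and turns the left side into $\det(X-A)\det(X+A)$, where the
    second factor is $(-1)^n\chi_A(-X)$. *)
Lemma char_poly_sqr (R : idomainType) n (A : 'M[R]_n) (s : seq R) :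
  char_poly A = \prod_(z <- s) ('X - z%:P) ->
  char_poly (A *m A) = \prod_(z <- s) ('X - (z ^+ 2)%:P).
Proof.
move=> charA.
have size_s : size s = n.
  by apply: succn_inj; rewrite -(size_char_poly A) charA size_prod_XsubC.
apply/eqP; rewrite -subr_eq0 -(@comp_poly_eq0 _ _ 'X^2) ?size_polyXn //.
rewrite comp_polyB subr_eq0; apply/eqP.
have comp_constmx m (B : 'M[R]_m) (q : {poly R}) :
    map_mx (comp_poly q) (map_mx polyC B) = map_mx polyC B.
  by rewrite -map_mx_comp; apply: eq_map_mx => a /=; rewrite comp_polyC.
have -> : char_poly (A *m A) \Po 'X^2
    = char_poly A * \det ('X%:M + map_mx polyC A).
  rewrite /char_poly -det_map_mx -det_mulmx; congr (\det _).
  rewrite /char_poly_mx raddfB /= map_scalar_mx /= comp_polyX.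
  rewrite comp_constmx map_mxM mulmxBl !mulmxDr -scalar_mxM -expr2 scalar_mxC.
  by rewrite opprD addrA addrK.
have -> : \det ('X%:M + map_mx polyC A) = (-1) ^+ n * (char_poly A \Po (- 'X)).
  rewrite /char_poly -det_map_mx -detZ; congr (\det _).
  rewrite /char_poly_mx raddfB /= map_scalar_mx /= comp_polyX.
  by rewrite comp_constmx scaleN1r opprB addrC raddfN opprK.
rewrite charA -size_s !rmorph_prod /=.
elim: s {charA size_s} => [|z s IHs]; first by rewrite !big_nil !mulr1.
rewrite !big_cons -IHs [(-1) ^+ _]exprS !comp_polyB !comp_polyX !comp_polyC
  polyC_exp.
ring.
Qed.

Lemma mxtrace_char_poly (R : comNzRingType) n (A : 'M[R]_n) (s : seq R) :
  char_poly A = \prod_(z <- s) ('X - z%:P) -> \tr A = \sum_(z <- s) z.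
Proof.
move=> charA.
have size_s : size s = n.
  by apply: succn_inj; rewrite -(size_char_poly A) charA size_prod_XsubC.
case: n A charA size_s => [|n] A charA size_s.
  by rewrite (size0nil size_s) big_nil [A]flatmx0 mxtrace0.
apply: oppr_inj; rewrite -char_poly_trace // charA -size_s coefPn_prod_XsubC //.
by rewrite size_s.
Qed.

(** * Cycles as edge sets *)

Lemma zip_rot (S T : Type) i (s : seq S) (t : seq T) :
  size s = size t -> zip (rot i s) (rot i t) = rot i (zip s t).
Proof.
move=> eq_st; have [le_i|lt_i] := leqP (size s) i.
  by rewrite !rot_oversize // ?size_zip -?eq_st ?minnn.
have size_take : size (zip (take i s) (take i t)) = i.
  by rewrite size_zip !size_takel -?eq_st ?minnn // ltnW.
rewrite -[in RHS](cat_take_drop i s) -[in RHS](cat_take_drop i t).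
rewrite zip_cat ?size_takel -?eq_st ?(ltnW lt_i) // -[X in rot X (_ ++ _)]size_take.
by rewrite rot_size_cat /rot zip_cat // !size_drop eq_st.
Qed.

Lemma eq_set2 (T : finType) (a b c d : T) :
  ([set a; b] == [set c; d]) = (a == c) && (b == d) || (a == d) && (b == c).
Proof.
apply/eqP/idP => [/setP E|/orP[]/andP[/eqP-> /eqP->] //]; last by rewrite setUC.
(* Testing the four elements for membership gives Boolean relations between the equality tests,
   which settle every case. *)
have := E a; have := E b; have := E c; have := E d; rewrite !inE !eqxx !orbT /=.
rewrite (eq_sym d a) (eq_sym d b) (eq_sym c a) (eq_sym c b).
by case: (a == c); case: (a == d); case: (b == c); case: (b == d).
Qed.

(** The fibres of [f] on [D] are the pairs [t], [r t]. In the applications [f] sends an ordering of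
    a cycle based at a vertex to its edge set, and [r] reverses the orientation. *)
Lemma card_imset_involution (T U : finType) (f : T -> U) (r : T -> T)
    (D : {set T}) :
  {in D, forall t, [/\ r t \in D, r t != t & f (r t) = f t]} ->
  {in D &, forall t u, f t = f u -> u = t \/ u = r t} ->
  #|D| = (2 * #|f @: D|)%N.
Proof.
move=> rD fD; rewrite -sum1_card (partition_big_imset f) /= mulnC.
rewrite -sum_nat_const; apply: eq_bigr => _ /imsetP[t Dt ->].
have [Drt rt_neq frt] := rD t Dt.
rewrite sum1dep_card (_ : [set _ | _] = [set t; r t]) ?cards2 1?eq_sym ?rt_neq //.
apply/setP => u; rewrite !inE; apply/andP/orP => [[Du /eqP ft]|].
  by have [->|->] := fD t u Dt Du (esym ft); [left | right].
by case=> /eqP->; rewrite ?frt.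
Qed.

(** The edge set occurring in [cycles], for sequences instead of tuples, so that it applies to
    rotations and to [x :: s]. *)
Definition cycle_edges (T : finType) (c : seq T) : {set {set T}} :=
  [set:: [seq [set p.1; p.2] | p <- zip c (rot 1 c)]].

Lemma cycle_edges_rot (T : finType) i (c : seq T) :
  cycle_edges (rot i c) = cycle_edges c.
Proof.
apply/setP => e; rewrite !inE rot_rot zip_rot ?size_rot //.
by rewrite map_rot mem_rot.
Qed.

Lemma cover_cycle_edges (T : finType) (c : seq T) : cover (cycle_edges c) =i c.
Proof.
move=> x; apply/bigcupP/idP => [[e]|cx].
  rewrite inE => /mapP[[a b] ab_c ->]; rewrite !inE => /orP[]/eqP->.
    by rewrite -(@unzip1_zip _ _ c (rot 1 c)) ?size_rot //; apply: (map_f fst ab_c).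
  rewrite -(mem_rot 1) -(@unzip2_zip _ _ c (rot 1 c)) ?size_rot //.
  exact: (map_f snd ab_c).
move: cx; rewrite -{1}(@unzip1_zip _ _ c (rot 1 c)) ?size_rot //.
case/mapP=> p p_c ->; exists [set p.1; p.2]; last by rewrite !inE eqxx.
by rewrite inE; apply: map_f.
Qed.

(** A cycle through [x] can be rotated to start at [x] without changing its edges, so only the other
    vertices remain to be chosen. *)
Lemma cycles_at_tuple (G : sgraph) m (x : G) :
  cycles_at m.+1 x = [set cycle_edges (x :: val c) | c : m.-tuple G
                        & ucycleb (@adj G) (x :: c)].
Proof.
apply/setP => C; rewrite inE; apply/andP/imsetP => [[/imsetP[c]]|[c]].
  rewrite inE => uc ->;
    rewrite -/(cycle_edges c) cover_cycle_edges => /rot_to[i s rc].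
  have size_s : size s == m.
    by rewrite -eqSS -[(size s).+1]/(size (x :: s)) -rc size_rot size_tuple.
  exists (Tuple size_s); last by rewrite /= -rc cycle_edges_rot.
  have : ucycle (@adj G) (rot i c) by rewrite rot_ucycle.
  by rewrite rc inE.
rewrite inE => uc ->; rewrite cover_cycle_edges mem_head; split=> //.
by apply/imsetP; exists [tuple of x :: c]; rewrite ?inE.
Qed.

Lemma card_cover_cycle (G : sgraph) m (C : {set {set G}}) :
  C \in cycles G m -> #|cover C| = m.
Proof.
case/imsetP => c; rewrite inE => /andP[_ uniq_c] ->.
by rewrite (eq_card (cover_cycle_edges c)) (card_uniqP uniq_c) size_tuple.
Qed.

(** Double counting of incident pairs of a vertex and a cycle. *)
Lemma sum_cycles_at (G : sgraph) m :
  (\sum_(x : G) #|cycles_at m x| = m * #|cycles G m|)%N.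
Proof.
transitivity (\sum_(x : G) \sum_(C in cycles G m | x \in cover C) 1)%N.
  by apply: eq_bigr => x _; rewrite sum1dep_card; apply: eq_card => C; rewrite !inE.
rewrite (exchange_big_dep (mem (cycles G m))) /= => [|x C _ /andP[]//].
rewrite mulnC -sum_nat_const; apply: eq_bigr => C cC.
by rewrite sum1dep_card -[RHS](card_cover_cycle cC); apply: eq_card => x;
  rewrite !inE cC.
Qed.

(** * Closed walks and powers of the adjacency matrix *)

Lemma adjacency_mulE (R : rcfType) (G : sgraph) m (M : 'M[R]_(#|G|, m)) x j :
  (adjacency R G *m M) (enum_rank x) j = \sum_(y | adj x y) M (enum_rank y) j.
Proof.
rewrite mxE (reindex _ (onW_bij _ (@enum_rank_bij G))) [RHS]big_mkcond.
by apply: eq_bigr => y _; rewrite mxE !enum_rankK mulr_natl mulrb.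
Qed.

Lemma natr_card (R : pzSemiRingType) (T : finType) (P : pred T) :
  #|[set t | P t]|%:R = \sum_t (P t)%:R :> R.
Proof.
rewrite -sum1dep_card natr_sum big_mkcond.
by apply: eq_bigr => t _; case: (P t).
Qed.

(** Three cyclically adjacent vertices are distinct, since there are no loops; hence [ucycleb]
    already counts all closed 3-walks. *)
Lemma closed_walks3 (R : rcfType) (G : sgraph) (x : G) :
  (adjacency R G ^+ 3) (enum_rank x) (enum_rank x)
    = #|[set p : G * G | ucycleb (@adj G) [:: x; p.1; p.2]]|%:R.
Proof.
rewrite natr_card -(pair_bigA _ (fun y z => (ucycleb (@adj G) [:: x; y; z])%:R)).
rewrite !exprS expr0 mulr1 adjacency_mulE big_mkcond; apply: eq_bigr => y _ /=.
rewrite adjacency_mulE [X in if _ then X else _]big_mkcond /=.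
case xy: (adj x y); last first.
  by rewrite big1 // => z _; rewrite /ucycleb /= xy.
apply: eq_bigr => z _; rewrite mxE !enum_rankK /ucycleb /= xy !inE.
case yz: (adj y z) => //=; case zx: (adj z x) => //=.
have neq (u v : G) : adj u v -> (u == v) = false by case: eqP => // ->;
  rewrite adj_irr.
by rewrite (neq _ _ xy) (neq _ _ yz) eq_sym (neq _ _ zx).
Qed.

(** Unlike for length 3, vertices may repeat, so [cycle] cannot be replaced by [ucycleb] here. *)
Lemma closed_walks4 (R : rcfType) (G : sgraph) (x : G) :
  (adjacency R G ^+ 4) (enum_rank x) (enum_rank x)
    = #|[set t : G * G * G | cycle (@adj G) [:: x; t.1.1; t.1.2; t.2]]|%:R.
Proof.
rewrite natr_card.
rewrite -(pair_bigA _ (fun p w => (cycle (@adj G) [:: x; p.1; p.2; w])%:R)) /=.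
rewrite -(pair_bigA _ (fun y z => \sum_w (cycle (@adj G) [:: x; y; z; w])%:R)) /=.
rewrite !exprS expr0 mulr1 adjacency_mulE big_mkcond; apply: eq_bigr => y _ /=.
rewrite adjacency_mulE [X in if _ then X else _]big_mkcond /=.
case: (adj x y); last by rewrite big1 // => z _; rewrite big1.
apply: eq_bigr => z _; rewrite adjacency_mulE [X in if _ then X else _]big_mkcond /=.
case: (adj y z); last by rewrite big1.
apply: eq_bigr => w _; rewrite mxE !enum_rankK andbT.
by case: (adj z w); case: (adj w x).
Qed.

(** * Counting triangles and quadrangles through a vertex *)

(** This recovers the two neighbours of the base vertex from the edge set alone. *)
Lemma mem_cycle_edges_head (T : finType) (x y u : T) s :
  uniq [:: x, y & s] -> u != x ->
  [set x; u] \in cycle_edges [:: x, y & s] -> u \in [:: y; last y s].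
Proof.
move=> /= /andP[xNys _] u_x; rewrite inE /= inE eq_set2 eqxx /=.
have [|xy /=] := eqVneq x y; first by move=> xy; rewrite xy mem_head in xNys.
rewrite !inE; case: (u == y) => //=.
(* Beyond the first edge, only the closing edge contains [x]; the induction discards the others. *)
elim: s y xNys {xy} => [|z s IHs] y /=.
  by rewrite !inE eq_set2 eqxx /= (negPf u_x) => /negPf->.
rewrite inE negb_or => /andP[x_y xNzs].
rewrite inE eq_set2 (negPf x_y) /=.
have /negPf-> : x != z by move: xNzs; rewrite inE negb_or => /andP[].
exact: IHs.
Qed.

(** The edge set determines the two neighbours of [x] up to order, and the swap reverses the
    orientation. *)
Lemma card_triangles_at (G : sgraph) (x : G) :
  #|[set p : G * G | ucycleb (@adj G) [:: x; p.1; p.2]]| = (2 * #|triangles_at x|)%N.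
Proof.
pose f (p : G * G) := cycle_edges [:: x; p.1; p.2].
have -> : triangles_at x
    = f @: [set p : G * G | ucycleb (@adj G) [:: x; p.1; p.2]].
  rewrite /triangles_at cycles_at_tuple; apply/setP => C; apply/imsetP/imsetP.
    by case=> [[[|y [|z [|]]] // i]]; rewrite inE => c ->; exists (y, z);
      rewrite ?inE.
  by case=> -[y z]; rewrite inE => c ->; exists [tuple y; z]; rewrite ?inE.
apply: (@card_imset_involution _ _ f (fun p => (p.2, p.1))) => [[y z]|[y z] [y' z']].
  rewrite !inE /ucycleb /= !inE !negb_or !andbT => /and3P[/and3P[xy yz zx]
    /andP[x_y x_z] y_z].
  rewrite (adj_sym x z) zx (adj_sym z y) yz (adj_sym y x) xy x_y x_z.
  rewrite (eq_sym z y) y_z xpair_eqE (eq_sym z y) (negPf y_z); split=> //.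
  apply/setP => e; rewrite !inE.
  rewrite (setUC [set z] [set x]) (setUC [set z] [set y]) (setUC [set y] [set x]).
  by do 3!case: (e == _).
rewrite !inE /= => /andP[_ uyz] /andP[_ uyz'] E.
have y'P : y' \in [:: y; z].
  apply: (mem_cycle_edges_head uyz); first by move: uyz';
    rewrite /= !inE (eq_sym x); case: eqP.
  by rewrite -[cycle_edges _]/(f (y, z)) E !inE eqxx.
have z'P : z' \in [:: y; z].
  apply: (mem_cycle_edges_head uyz); first by move: uyz';
    rewrite /= !inE (eq_sym x z'); case: (z' == x); rewrite ?orbT.
  by rewrite -[cycle_edges _]/(f (y, z)) E !inE (setUC [set x]) eqxx !orbT.
move: uyz' y'P z'P; rewrite /= !inE => /and3P[_ y'_z' _].
by case/orP=> /eqP yE; case/orP=> /eqP zE; move: y'_z'; rewrite yE zE ?eqxx //;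
  [left|right].
Qed.

(** As for triangles; reversal exchanges the two neighbours of [x] and fixes the vertex opposite to
    it. *)
Lemma card_ucycles4 (G : sgraph) (x : G) :
  #|[set t : G * G * G | ucycleb (@adj G) [:: x; t.1.1; t.1.2; t.2]]|
    = (2 * #|quadrangles_at x|)%N.
Proof.
pose f (t : G * G * G) := cycle_edges [:: x; t.1.1; t.1.2; t.2].
have -> : quadrangles_at x
    = f @: [set t : G * G * G | ucycleb (@adj G) [:: x; t.1.1; t.1.2; t.2]].
  rewrite /quadrangles_at cycles_at_tuple; apply/setP => C; apply/imsetP/imsetP.
    case=> [[[|y [|z [|w []]]] // i]]; rewrite inE => c ->.
    by exists (y, z, w); rewrite ?inE.
  by case=> -[[y z] w]; rewrite inE => c ->; exists [tuple y; z; w]; rewrite ?inE.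
apply: (@card_imset_involution _ _ f (fun t => (t.2, t.1.2, t.1.1)))
  => [[[y z] w]|[[y z] w] [[y' z'] w']].
  rewrite !inE /ucycleb /= !inE !negb_or !andbT.
  case/andP=> /and4P[xy yz zw wx] /and3P[/and3P[x_y x_z x_w] /andP[y_z y_w] z_w].
  rewrite (adj_sym x w) wx (adj_sym w z) zw (adj_sym z y) yz (adj_sym y x) xy.
  rewrite x_y x_z x_w !(eq_sym w) z_w y_w (eq_sym z y) y_z.
  rewrite !xpair_eqE (eq_sym w) (negPf y_w); split=> //.
  apply/setP => e; rewrite !inE (setUC [set w] [set x]) (setUC [set w] [set z]).
  rewrite (setUC [set z] [set y]) (setUC [set y] [set x]).
  by do 4!case: (e == _).
rewrite !inE /= => /andP[_ uc] /andP[_ uc'] E.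
have y'P : y' \in [:: y; w].
  apply: (mem_cycle_edges_head uc).
    by move: uc'; rewrite /= !inE (eq_sym x); case: eqP.
  by rewrite -[cycle_edges _]/(f (y, z, w)) E !inE eqxx.
have w'P : w' \in [:: y; w].
  apply: (mem_cycle_edges_head uc).
    by move: uc'; rewrite /= !inE (eq_sym x w'); case: (w' == x); rewrite ?orbT.
  by rewrite -[cycle_edges _]/(f (y, z, w)) E !inE (setUC [set x]) eqxx !orbT.
(* The opposite vertex lies on no edge at [x]; it is found by elimination in the common vertex
   set. *)
have z'P : z' \in [:: x; y; z; w].
  rewrite -cover_cycle_edges -[cycle_edges _]/(f (y, z, w)) E.
  by rewrite cover_cycle_edges !inE eqxx !orbT.
move: uc' y'P w'P z'P; rewrite /= !inE !negb_or !andbT.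
case/and3P=> /and3P[x_y' x_z' x_w'] /andP[y'_z' y'_w'] z'_w'.
rewrite (eq_sym z' x) (negPf x_z') /=.
case/orP=> /eqP yE; case/orP=> /eqP wE; move: y'_w' y'_z' z'_w';
  rewrite yE wE ?eqxx //.
  by move=> _; rewrite (eq_sym y z') => /negPf-> /negPf-> /=;
    rewrite orbF => /eqP->; left.
by move=> _; rewrite (eq_sym w z') => /negPf-> /negPf-> /=;
  rewrite orbF => /eqP->; right.
Qed.

(* A closed 4-walk x y z w which is not a cycle has z = x, or else w = y. *)
Lemma card_closed_walks4 (G : sgraph) (k : nat) (x : G) :
  regular_graph G k ->
  #|[set t : G * G * G | cycle (@adj G) [:: x; t.1.1; t.1.2; t.2]]|
    = (2 * #|quadrangles_at x| + k ^ 2 + k * k.-1)%N.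
Proof.
move=> reg; rewrite -card_ucycles4.
set W := [set t | _]; set D := [set t | _].
set N := fun y : G => [set z | adj y z].
have neq (u v : G) : adj u v -> (u == v) = false.
  by case: eqP => // ->; rewrite adj_irr.
rewrite -(cardsID [set t | t.1.2 == x] W) -(cardsID [set t | t.1.1 == t.2] (W :\:
  _)).
(* With [z = x], the vertices [y] and [w] are independent neighbours of [x]. *)
have -> : #|W :&: [set t | t.1.2 == x]| = (k ^ 2)%N.
  rewrite -mulnn -{1}(reg x) -(reg x) -cardsX.
  rewrite -(card_imset (f := fun p : G * G => (p.1, x, p.2))).
    apply: eq_card => -[[y z] w]; rewrite !inE /= andbT; apply/andP/imsetP.
      case=> [/and4P[xy yz zw wx] /eqP zx].
      by exists (y, w); rewrite ?inE /= ?xy ?(adj_sym x w) ?wx ?zx.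
    case=> -[y1 w1]; rewrite !inE /= => /andP[xy xw] [-> -> ->].
    by rewrite xy (adj_sym y1) xy xw (adj_sym w1) xw.
  by case=> [y w] [y' w'] /= [-> ->].
(* With [w = y] and [z] distinct from [x], [y] is a neighbour of [x] and [z] one of the [k.-1] other
   neighbours of [y]. *)
have -> : #|(W :\: [set t | t.1.2 == x]) :&: [set t | t.1.1 == t.2]| = (k * k.-1)%N.
  transitivity (\sum_(y | adj x y) #|N y :\ x|)%N.
    rewrite -sum1_card.
    rewrite (eq_bigr (fun y => \sum_(z in N y :\ x) 1)%N) => [|y _];
      last by rewrite sum1_card.
    rewrite pair_big_dep /= (reindex_onto (fun p : G * G => (p.1, p.2, p.1)) fst) /=.
      apply: eq_bigl => -[y z]; rewrite !inE /= !eqxx !andbT.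
      rewrite (adj_sym z y) (adj_sym y x).
      by case: (z == x); case: (adj x y); case: (adj y z).
    by move=> [[y z] w]; rewrite !inE /= => /andP[_ /eqP->].
  rewrite (eq_bigr (fun _ => k.-1)) => [|y xy].
    rewrite sum_nat_const; congr (_ * _)%N; rewrite -(reg x).
    by apply: eq_card => y; rewrite !inE.
  by rewrite -(reg y) (cardsD1 x [set _ | _]) inE adj_sym xy.
(* Consecutive vertices differ anyway, so excluding [z = x] and [y = w] amounts to [uniq]. *)
suff -> : (W :\: [set t | t.1.2 == x]) :\: [set t | t.1.1 == t.2] = D.
  by rewrite addnA addnC addnA.
apply/setP => -[[y z] w]; rewrite !inE /ucycleb /= !inE !andbT.
case xy: (adj x y) => /=; last by rewrite !andbF.
case yz: (adj y z) => /=; last by rewrite !andbF.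
case zw: (adj z w) => /=; last by rewrite !andbF.
case wx: (adj w x) => /=; last by rewrite !andbF.
rewrite (neq _ _ xy) (neq _ _ yz) (neq _ _ zw) (eq_sym x w) (neq _ _ wx) /=.
by rewrite (eq_sym x z) orbF !andbT andbC.
Qed.

(** * Traces, the valency eigenspace and the cube of the adjacency matrix *)

(** Listing each eigenvalue as often as its multiplicity splits the characteristic polynomial into
    linear factors; [char_poly_sqr] then handles the square. *)
Lemma spectrum_trace (R : rcfType) (G : sgraph) (s : seq (R * nat)) :
  has_spectrum G s ->
  [/\ #|G| = (\sum_(p <- s) p.2)%N,
      \tr (adjacency R G) = \sum_(p <- s) p.1 * p.2%:R &
      \tr (adjacency R G *m adjacency R G) = \sum_(p <- s) p.1 ^+ 2 * p.2%:R].
Proof.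
case=> _; set A := adjacency R G; pose z := flatten [seq nseq p.2 p.1 | p <- s].
have big_z (f : R -> R) : \sum_(a <- z) f a = \sum_(p <- s) f p.1 * p.2%:R.
  rewrite big_flatten big_map; apply: eq_bigr => p _.
  by rewrite big_nseq iter_addr addr0 mulr_natr.
have -> : \prod_(p <- s) ('X - p.1%:P) ^+ p.2 = \prod_(a <- z) ('X - a%:P).
  rewrite big_flatten big_map; apply: eq_bigr => p _.
  by rewrite big_nseq iter_mulr mulr1.
move=> charA.
have size_z : size z = #|G|.
  by apply: succn_inj; rewrite -(size_char_poly A) charA size_prod_XsubC.
split.
- rewrite -size_z size_flatten /shape -map_comp sumnE big_map.
  by apply: eq_bigr => p _; rewrite /= size_nseq.
- by rewrite (mxtrace_char_poly charA) (big_z id).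
- have charAA : char_poly (A *m A) = \prod_(a <- [seq b ^+ 2 | b <- z]) ('X - a%:P).
    by rewrite big_map; apply: char_poly_sqr.
  by rewrite (mxtrace_char_poly charAA) big_map (big_z (fun a => a ^+ 2)).
Qed.

Lemma trmx_adjacency (R : rcfType) (G : sgraph) :
  (adjacency R G)^T = adjacency R G.
Proof. by apply/matrixP => i j; rewrite !mxE adj_sym. Qed.

Lemma adjacency_diag (R : rcfType) (G : sgraph) i : adjacency R G i i = 0.
Proof. by rewrite mxE adj_irr. Qed.

Lemma adjacency_sqr_diag (R : rcfType) (G : sgraph) (k : nat) i :
  regular_graph G k -> (adjacency R G *m adjacency R G) i i = k%:R.
Proof.
move=> reg; rewrite -(enum_valK i) adjacency_mulE -(reg (enum_val i)) natr_card.
rewrite big_mkcond; apply: eq_bigr => y _; rewrite mxE !enum_rankK (adj_sym y).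
by case: (adj _ _).
Qed.

(* Summing over edges, the Dirichlet energy of [M] vanishes. *)
Lemma valency_eigenspace (R : rcfType) (G : sgraph) (k m : nat)
    (M : 'M[R]_(#|G|, m)) :
  connected_graph G -> regular_graph G k ->
  adjacency R G *m M = k%:R *: M -> forall i i' j, M i j = M i' j.
Proof.
move=> conn reg AM i i' j; pose v (x : G) := M (enum_rank x) j.
suff v_edge : forall x y, adj x y -> v x = v y.
  rewrite -(enum_valK i) -(enum_valK i') -!/(v _).
  have /connectP[p] := conn (enum_val i) (enum_val i').
  elim: p (enum_val i) => [|z p IHp] x /=; first by move=> _ ->.
  by case/andP=> /v_edge-> /IHp; apply.
have sum_v x : \sum_(y | adj x y) v y = k%:R * v x.
  by rewrite -adjacency_mulE AM mxE.
have deg (x : G) (a : R) : \sum_(y | adj x y) a = k%:R * a.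
  by rewrite sumr_const -(reg x) mulr_natl; congr (_ *+ _); apply: eq_card => y;
    rewrite inE.
have energy : \sum_x \sum_(y | adj x y) (v x - v y) ^+ 2 = 0.
  (* By the eigenvalue equation the cross term is $-2kv(x)^2$, which outweighs the $kv(x)^2$ from
     the first square. *)
  have E x : \sum_(y | adj x y) (v x - v y) ^+ 2
      = \sum_(y | adj x y) v y ^+ 2 - k%:R * v x ^+ 2.
    rewrite (eq_bigr (fun y => v x ^+ 2 + (v y ^+ 2 - 2 * v x * v y))) => [|y _];
      last by ring.
    rewrite big_split sumrB /= (deg x) -mulr_sumr sum_v; ring.
  (* After exchanging the sums, each $v(y)^2$ is counted once per neighbour of $y$, that is $k$
     times, and all cancels. *)
  rewrite (eq_bigr _ (fun x _ => E x)) sumrB (exchange_big_dep xpredT) //=.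
  rewrite -sumrB big1 // => y _; rewrite -(deg y); apply/eqP; rewrite subr_eq0;
    apply/eqP.
  by apply: eq_bigl => x; rewrite adj_sym.
move=> x y xy; apply/eqP; rewrite -subr_eq0 -sqrf_eq0.
have sq_ge0 z : 0 <= \sum_(w | adj z w) (v z - v w) ^+ 2.
  by apply: sumr_ge0 => w _; apply: sqr_ge0.
have /eqP := energy; rewrite psumr_eq0 // => /allP/(_ x); rewrite mem_index_enum.
move=> /(_ isT) /=; rewrite psumr_eq0 => [|w _]; last exact: sqr_ge0.
by move=> /allP/(_ y); rewrite mem_index_enum xy => /(_ isT).
Qed.

(* Every column of [B] is an eigenvector for the valency, hence constant; [B] being
   symmetric, it is a multiple of the all-ones matrix, determined by its row sums. *)
Lemma adjacency_exp3 (R : rcfType) (G : sgraph) (k alpha beta gamma : nat) :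
  connected_graph G -> regular_graph G k ->
  has_spectrum G
    [:: (k%:R : R, 1%N); (k%:R / 2, alpha); (0, beta); (- (k%:R / 2), gamma)] ->
  adjacency R G ^+ 3 = (k%:R ^+ 2 / 4) *: adjacency R G
    + const_mx (3 * k%:R ^+ 3 / (4 * #|G|%:R) : R).
Proof.
move=> conn reg [_ charA]; set A := adjacency R G in charA *.
have symA : A^T = A := trmx_adjacency R G.
pose B := A ^+ 3 - (k%:R ^+ 2 / 4) *: A.
have symB : B^T = B.
  rewrite /B linearB linearZ /= symA; congr (_ - _).
  by rewrite !exprS expr0 mulr1 -!mulmxE !trmx_mul symA mulmxA.
(* Since $B=A(A-k/2)(A+k/2)$, this is the annihilating product of the four distinct factors. *)
have AB : A *m B = k%:R *: B.
  have := sym_char_poly_annihilator symA charA.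
  rewrite !big_cons big_nil mulr1 /= => E.
  apply/eqP; rewrite -subr_eq0 -mul_scalar_mx -mulmxBl -[X in _ == X]E.
  apply/eqP; congr (_ * _).
  rewrite raddf0 subr0 raddfN opprK /B !exprS !expr0 !mulr1 -!mulmxE.
  rewrite mulmxDr scalar_mxC mul_scalar_mx mulmxBl mul_scalar_mx mulmxDr scalerDr.
  rewrite -scalemxAr scalerA opprD addrA addrK.
  by congr (_ - _ *: _); field.
have constB i j i' j' : B i j = B i' j'.
  have colB := valency_eigenspace conn reg AB.
  have symBE l m : B l m = B m l by rewrite -[in LHS]symB mxE.
  by rewrite (colB i i' j) (symBE i' j) (colB j j') (symBE j').
apply/matrixP => i j; rewrite -(subrK ((k%:R ^+ 2 / 4) *: A) (A ^+ 3)) -/B addrC.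
rewrite [LHS]mxE [RHS]mxE; congr (_ + _); rewrite [RHS]mxE.
have sumA l : \sum_m A l m = k%:R.
  transitivity ((A *m const_mx 1 : 'cV_#|G|) l 0).
    by rewrite mxE; apply: eq_bigr => m _; rewrite [const_mx _ _ _]mxE mulr1.
  rewrite -(enum_valK l) adjacency_mulE -(reg (enum_val l)) natr_card big_mkcond.
  by apply: eq_bigr => y _; rewrite [const_mx _ _ _]mxE; case: (adj _ _).
have A1 : A *m const_mx 1 = k%:R *: const_mx 1 :> 'cV_#|G|.
  apply/matrixP => l m; rewrite !mxE mulr1 -(sumA l).
  by apply: eq_bigr => u _; rewrite [const_mx _ _ _]mxE mulr1.
have B1 : B *m const_mx 1 = (k%:R ^+ 3 - k%:R ^+ 2 / 4 * k%:R) *: const_mx 1 :>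
  'cV_#|G|.
  rewrite mulmxBl !exprS !expr0 !mulr1 -!mulmxA -scalemxAl !(A1, =^~ scalemxAr)
    !scalerA.
  by rewrite scalerBl -!mulrA.
have := congr1 (fun M : 'cV_#|G| => M i 0) B1.
rewrite [in RHS]mxE [in RHS]mxE mulr1 mxE.
rewrite (eq_bigr (fun=> B i j)) => [|m _];
  last by rewrite [const_mx _ _ _]mxE mulr1; apply: constB.
rewrite sumr_const card_ord -[B i j *+ _]mulr_natr => E.
have G_neq0 : #|G|%:R != 0 :> R.
  by rewrite pnatr_eq0 -lt0n; apply: leq_ltn_trans (ltn_ord i).
(* The row sum of [B] is $k^3-k^3/4=3k^3/4$, shared equally by $N$ entries. *)
have solve (b N : R) : N != 0 -> b * N = k%:R ^+ 3 - k%:R ^+ 2 / 4 * k%:R ->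
    b = 3 * k%:R ^+ 3 / (4 * N).
  by move=> N_neq0 bN; apply: (mulIf N_neq0); rewrite bN; field.
exact: solve G_neq0 E.
Qed.

(** * Multiplicities and cycle counts from the spectrum *)

(** The trace of $A$ is 0, which gives $\gamma=\alpha+2$; the trace of $A^2$ is $nk$, which then
    gives $k(\alpha+3)=2n$. *)
Lemma regular_spectrum_multiplicities (R : rcfType) (G : sgraph) (k alpha beta
  gamma : nat) :
  regular_graph G k -> (0 < k)%N ->
  has_spectrum G
    [:: (k%:R : R, 1%N); (k%:R / 2, alpha); (0, beta); (- (k%:R / 2), gamma)] ->
  [/\ #|G| = (1 + alpha + beta + gamma)%N, gamma = alpha.+2 &
      (k * (alpha + 3) = 2 * #|G|)%N].
Proof.
move=> reg k_gt0 /spectrum_trace[cardG trA trAA].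
have k_neq0 : k%:R != 0 :> R by rewrite pnatr_eq0 -lt0n.
rewrite !big_cons !big_nil /= ?addn0 !addr0 in cardG trA trAA.
have trA0 : \tr (adjacency R G) = 0 by rewrite /mxtrace big1 // => i _;
  rewrite adjacency_diag.
have trAAk : \tr (adjacency R G *m adjacency R G) = #|G|%:R * k%:R.
  rewrite /mxtrace (eq_bigr (fun=> k%:R)) => [|i _]; last exact: adjacency_sqr_diag.
  by rewrite sumr_const card_ord mulr_natl.
rewrite {}trA0 in trA; rewrite {}trAAk in trAA.
have gammaE : gamma = alpha.+2.
  apply/eqP; rewrite -(eqr_nat R) -addn2 natrD; apply/eqP/(mulfI k_neq0).
  by move: trA; clear; lra.
split=> //; first by rewrite cardG !addnA.
apply/eqP; rewrite -(eqr_nat R) !natrM natrD; apply/eqP/(mulfI k_neq0).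
move: trAA; rewrite gammaE -addn2 natrD => E.
by rewrite [RHS]mulrCA (mulrC k%:R #|G|%:R) E; field.
Qed.

(** The predicate [has_spectrum] admits zero exponents. Each eigenvalue is listed with a positive
    one, and there are as many eigenvalues as list entries. *)
Lemma multiplicity_gt0 (R : rcfType) (G : sgraph) (s : seq (R * nat)) p :
  has_spectrum G s -> has_distinct_eigenvalues (adjacency R G) (size s) ->
  p \in s -> (0 < p.2)%N.
Proof.
case=> uniq_s charA [e [uniq_e size_e eig_e]] ps.
have root_s a : a \in e -> exists2 q, q \in s & (0 < q.2)%N && (a == q.1).
  rewrite -eig_e -[a \in _]/(eigenvalue _ a) eigenvalue_root_char charA -(big_map
    _ xpredT id) -[root _ _]negbK.
  rewrite root_bigmul => /allPn[_ /mapP[q qs ->]]; rewrite negbK => rq;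
    exists q => //.
  by case: q.2 rq => [|m]; rewrite ?root_exp_XsubC // expr0 (negPf (root1 _)).
have sub : {subset e <= unzip1 s}.
  by move=> a /root_s[q qs /andP[_ /eqP->]]; apply: map_f.
have [_ e_s] := uniq_min_size uniq_e sub (eq_leq (etrans (size_map _ _) (esym
  size_e))).
have /root_s[q qs /andP[q_gt0 /eqP pq]] : p.1 \in e by rewrite e_s map_f.
suff -> : p = q by [].
rewrite -(nth_index p ps) -(nth_index p qs); congr nth; apply/eqP.
rewrite -(nth_uniq p.1 _ _ uniq_s) ?size_map ?index_mem //.
by rewrite !(nth_map p) ?index_mem // !nth_index // pq.
Qed.

(** Diagonal entries of $A^3$ and $A^4$ are compared with the closed walk counts. Denominators are
    cleared and the negative term $-8nk^2$ is moved to the left, to stay within [nat]. *)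
Lemma swr_cycle_counts (R : rcfType) (G : sgraph) (k alpha beta gamma : nat) (x :
  G) :
  connected_graph G -> regular_graph G k -> (0 < k)%N ->
  has_spectrum G
    [:: (k%:R : R, 1%N); (k%:R / 2, alpha); (0, beta); (- (k%:R / 2), gamma)] ->
  (8 * #|G| * #|triangles_at x| = 3 * k ^ 3)%N /\
  (8 * #|G| * #|quadrangles_at x| + 8 * #|G| * k ^ 2
     = k * (3 * k ^ 3 + #|G| * k ^ 2 + 4 * #|G|))%N.
Proof.
move=> conn reg k_gt0 spec; have A3 := adjacency_exp3 conn reg spec.
have G_neq0 : #|G|%:R != 0 :> R.
  by rewrite pnatr_eq0 -lt0n; apply/card_gt0P; exists x.
set i := enum_rank x.
split; apply/eqP; rewrite -(eqr_nat R) !(natrM, natrD, natrX); apply/eqP.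
  have := closed_walks3 R x.
  rewrite -/i card_triangles_at A3 natrM mxE [X in X + _]mxE adjacency_diag mulr0
    add0r mxE => E.
  move: (#|G|%:R) (#|triangles_at x|%:R) G_neq0 E => N t N_neq0 E.
  transitivity (4 * N * (2 * t)); first by ring.
  by rewrite -E; field.
have := closed_walks4 R x.
(* From $A^4=A\cdot A^3$ the diagonal entry is $k^3/4+k\cdot 3k^3/(4n)$. *)
rewrite -/i (card_closed_walks4 x reg) exprS A3 -mulmxE mulmxDr -scalemxAr mxE [X
  in X + _]mxE.
rewrite (adjacency_sqr_diag _ _ reg) mxE.
rewrite (eq_bigr (fun m => adjacency R G i m * (3 * k%:R ^+ 3 / (4 * #|G|%:R))))
  => [|m _]; last first.
  by rewrite [const_mx _ _ _]mxE.
have -> : \sum_m adjacency R G i m * (3 * k%:R ^+ 3 / (4 * #|G|%:R))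
    = k%:R * (3 * k%:R ^+ 3 / (4 * #|G|%:R)).
  (* Entries 0 and 1 equal their squares, so the row sum is the diagonal entry [k] of the square. *)
  rewrite -mulr_suml; congr (_ * _).
  rewrite -(adjacency_sqr_diag R i reg) mxE; apply: eq_bigr => m _.
  by rewrite -[in X in _ * X]trmx_adjacency [_^T _ _]mxE !mxE; case: (adj _ _);
    rewrite ?mulr1 ?mulr0.
rewrite !(natrD, natrM, natrX).
have -> : k.-1%:R = k%:R - 1 :> R by rewrite -subn1 natrB.
move: (#|G|%:R) (#|quadrangles_at x|%:R) G_neq0 => N q N_neq0 E.
transitivity (4 * N * (2 * q + k%:R ^+ 2 + k%:R * (k%:R - 1))
  + 4 * N * k%:R ^+ 2 - 4 * N * k%:R * (k%:R - 1)); first by ring.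
by rewrite -E; field.
Qed.

(** * Deduction of the four claims over the rationals *)

Theorem theorem5p1 (R : rcfType) (G : sgraph) (n k alpha beta gamma : nat)
    (hn : #|G| = n)
    (hG : genuine_swr R G)
    (hk : regular_graph G k)
    (hspec : has_spectrum G
       [:: (k%:R : R, 1%N); (k%:R / 2, alpha); (0, beta); (- (k%:R / 2), gamma)]) :
  [/\ (* (i) *)
      [/\ alpha%:R = 2 * n%:R / k%:R - 3 :> rat,
          beta%:R = n%:R + 3 - 4 * n%:R / k%:R :> rat,
          gamma%:R = 2 * n%:R / k%:R - 1 :> rat &
          [/\ (0 < alpha)%N, (0 < beta)%N & (0 < gamma)%N]],
      (* (ii) *)
      (2 * k <= n)%N /\ (n%:R <= 3 / 4 * k%:R ^+ 3 :> rat),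
      (* (iii) *)
      forall x : G, #|triangles_at x|%:R = 3 * k%:R ^+ 3 / (8 * n%:R) :> rat &
      (* (iv) *)
      #|quadrangles G|%:R
        = k%:R / 32 * (3 * k%:R ^+ 3 + n%:R * k%:R ^+ 2 - 8 * n%:R * k%:R + 4 * n%:R)
          :> rat
      /\ forall x : G,
        #|quadrangles_at x|%:R
          = k%:R / (8 * n%:R)
            * (3 * k%:R ^+ 3 + n%:R * k%:R ^+ 2 - 8 * n%:R * k%:R + 4 * n%:R) :> rat].

Proof.
have [conn _ _ eigs] := hG.
(* For [k = 0] the listed eigenvalues would coincide. *)
have k_gt0 : (0 < k)%N.
  have [/= /andP[+ _] _] := hspec; rewrite lt0n -(pnatr_eq0 R).
  by apply: contraNneq => ->; rewrite mul0r mem_head.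
have [cardG gammaE alphaE] := regular_spectrum_multiplicities hk k_gt0 hspec.
have mult_gt0 := multiplicity_gt0 hspec eigs.
have alpha_gt0 : (0 < alpha)%N by apply: (mult_gt0 (k%:R / 2, alpha));
  rewrite !inE eqxx ?orbT.
have beta_gt0 : (0 < beta)%N by apply: (mult_gt0 (0, beta)); rewrite !inE eqxx ?orbT.
have counts x := swr_cycle_counts x conn hk k_gt0 hspec.
rewrite hn in cardG alphaE counts.
have n_gt0 : (0 < n)%N by rewrite cardG.
have k_neq0 : k%:R != 0 :> rat by rewrite pnatr_eq0 -lt0n.
have n_neq0 : n%:R != 0 :> rat by rewrite pnatr_eq0 -lt0n.
have [x _] : exists x : G, x \in G by apply/card_gt0P; rewrite hn.
have tri (y : G) : 8 * n%:R * #|triangles_at y|%:R = 3 * k%:R ^+ 3 :> rat.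
  by have [E _] := counts y; rewrite -natrX -!natrM E.
have quad (y : G) : #|quadrangles_at y|%:R = k%:R / (8 * n%:R)
    * (3 * k%:R ^+ 3 + n%:R * k%:R ^+ 2 - 8 * n%:R * k%:R + 4 * n%:R) :> rat.
  have [_ /(congr1 (fun m => m%:R : rat))] := counts y.
  rewrite !(natrM, natrD, natrX) => /(canRL (addrK _)) E.
  apply: (mulfI (mulf_neq0 (_ : 8 != 0) n_neq0)) => //.
  by rewrite E; field.
have alphaQ : k%:R * (alpha%:R + 3) = 2 * n%:R :> rat.
  by rewrite -[3]/(3%:R) -natrD -!natrM alphaE.
have nQ : n%:R = 1 + alpha%:R + beta%:R + gamma%:R :> rat by rewrite cardG !natrD.
have gammaQ : gamma%:R = alpha%:R + 2 :> rat by rewrite gammaE -addn2 natrD.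
(* With this value of $n/k$ the formulas in (i) become linear. *)
have nkE : n%:R / k%:R = (alpha%:R + 3) / 2 :> rat.
  have -> : n%:R = k%:R * (alpha%:R + 3) / 2 :> rat by rewrite alphaQ; field.
  by field.
split.
- by rewrite -!mulrA nkE; split; [lra | lra | lra | split=> //; rewrite gammaE].
- split.
    (* As $\alpha\ge1$, $4k\le k(\alpha+3)=2n$. *)
    have : (k * 4 <= k * (alpha + 3))%N by rewrite leq_mul2l -[4%N]/(1 + 3)%N
      leq_add2r alpha_gt0 orbT.
    by rewrite alphaE; lia.
  (* Every vertex lies on a triangle because $8nt_x=3k^3>0$; so $n\le\frac38k^3$, which is stronger
     than the claim. *)
  have n_le : (8 * n <= 3 * k ^ 3)%N.
    have [triE _] := counts x; rewrite -triE leq_pmulr // lt0n; apply/eqP => t0.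
    by move: triE; rewrite t0 muln0 => /esym/eqP;
      rewrite muln_eq0 expn_eq0 /= eqn0Ngt k_gt0.
  have k3_ge0 : 0 <= k%:R ^+ 3 :> rat by rewrite exprn_ge0 ?ler0n.
  by move: n_le; rewrite -(ler_nat rat) [X in X <= _]natrM [X in _ <= X]natrM
    natrX; lra.
- by move=> y; rewrite -(tri y); field.
split=> //.
(* As $q_x$ is the same for all vertices, $nq_x=4q$. *)
have := sum_cycles_at G 4; move/(congr1 (fun m => m%:R : rat)).
rewrite natr_sum natrM (eq_bigr _ (fun y _ => quad y)) sumr_const hn -mulr_natr => E.
by apply: (@mulfI _ 4) => //; rewrite -/(cycles G 4) -E; field.
Qed.
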